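(* Let $P$ and $Q$ be finite posets, and let $x \in P$ be such that $P - x$ is a fold of $P$, i.e., there exists $y \in P$ with $y \neq x$, $\mathcal{U}(y) \supseteq \mathcal{U}(x)$ and $\mathcal{D}(y) \supseteq \mathcal{D}(x)$. Then the barycentric subdivision $\mathrm{Bd}\,\mathrm{Hom}(P,Q)$ collapses onto $\mathrm{Bd}\,\mathrm{Hom}(P-x,Q)$, and $\mathrm{Hom}(Q,P)$ collapses onto $\mathrm{Hom}(Q,P-x)$.
   Context: For a finite poset $P$ and $z \in P$, $\mathcal{U}(z)$ denotes the set of elements of $P$ covering $z$ and $\mathcal{D}(z)$ the set of elements covered by $z$; $P-x$ denotes the induced subposet on $P\setminus\{x\}$. For finite posets $A,B$, the poset homomorphism complex $\mathrm{Hom}(A,B)$ is the following subcomplex of the product of simplices $\prod_{a\in A}\Delta_B$ (where $\Delta_B$ is the simplex with vertex set $B$): its cells are the tuples $(X_a)_{a\in A}$ of nonempty subsets $X_a\subseteq B$ such that every map $\eta:A\to B$ with $\eta(a)\in X_a$ for all $a$ is strictly order-preserving ($a<a'$ implies $\eta(a)<\eta(a')$); the cell $(X_a)$ is the product of the simplices $\Delta_{X_a}$, and cells are ordered by $X\le Y$ iff $X_a\subseteq Y_a$ for all $a$. $\mathrm{Bd}\,X$ denotes the barycentric subdivision of a polyhedral cell complex $X$, i.e. the order complex of its face poset. Here $\mathrm{Hom}(Q,P-x)$ is regarded as the subcomplex of $\mathrm{Hom}(Q,P)$ of cells not using $x$, and the face poset of $\mathrm{Hom}(P-x,Q)$ is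 identified with the subposet of the face poset of $\mathrm{Hom}(P,Q)$ consisting of those $\eta$ with $\eta(x)=\eta(y)$ (so $\mathrm{Bd}\,\mathrm{Hom}(P-x,Q)$ is viewed as a subcomplex of $\mathrm{Bd}\,\mathrm{Hom}(P,Q)$). *)

(* Defs.v *)
From HB Require Import structures.
From mathcomp Require Import all_boot all_order.

Set Implicit Arguments.
Unset Strict Implicit.
Unset Printing Implicit Defensive.

Import Order.TTheory.
Local Open Scope order_scope.

Definition covers (d : Order.disp_t) (P : finPOrderType d) (z w : P) : bool :=
  (z < w) && ~~ [exists u : P, (z < u) && (u < w)].

Definition upcovers (d : Order.disp_t) (P : finPOrderType d) (z : P) : {set P} :=
  [set w | covers z w].

Definition downcovers (d : Order.disp_t) (P : finPOrderType d) (z : P)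
  : {set P} :=
  [set w | covers w z].

Record del (d : Order.disp_t) (P : finPOrderType d) (x : P) : Type :=
  Del { del_val : P; _ : del_val != x }.

HB.instance Definition _ (d : Order.disp_t) (P : finPOrderType d) (x : P) :=
  [isSub for @del_val d P x].
HB.instance Definition _ (d : Order.disp_t) (P : finPOrderType d) (x : P) :=
  [Finite of del x by <:].
HB.instance Definition _ (d : Order.disp_t) (P : finPOrderType d) (x : P) :=
  [SubChoice_isSubPOrder of del x by <: with d].

(* A finite polyhedral complex is given by the set of its nonempty cells,     *)
(* ordered by the face relation [le]. If [s] has [t] as its only proper       *)
(* coface in [K], then [t] is maximal in [K] and dim t = dim s + 1, since a   *)
(* face of codimension at least 2 of a polytope lies in at least two facets.  *)
Definition elem_collapse (T : finType) (le : rel T) (K L : {set T}) : Prop :=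
  exists s t : T,
    [/\ s \in K, t \in K, (s != t) && le s t,
        {in K, forall r, le s r -> r = s \/ r = t}
      & L = K :\: [set s; t]].

Inductive collapses (T : finType) (le : rel T) (K : {set T})
  : {set T} -> Prop :=
| collapses_refl : collapses le K K
| collapses_step (L M : {set T}) :
    collapses le K L -> elem_collapse le L M -> collapses le K M.

Definition simplex_face (V : finType) : rel {set V} := fun s t => s \subset t.

Definition order_complex (T : finType) (le : rel T) (F : {set T})
  : {set {set T}} :=
  [set C : {set T} | [&& C != set0, C \subset F &
     [forall u in C, forall v in C, le u v || le v u]]].

Section Hom.
Variables (dA dB : Order.disp_t) (A : finPOrderType dA) (B : finPOrderType dB).

Definition strict_mono (eta : {ffun A -> B}) : bool :=
  [forall a, forall a', (a < a') ==> (eta a < eta a')].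

Definition is_hom_cell (X : {ffun A -> {set B}}) : bool :=
  [forall a, X a != set0] &&
  [forall eta : {ffun A -> B}, [forall a, eta a \in X a] ==> strict_mono eta].

Definition Hom : {set {ffun A -> {set B}}} := [set X | is_hom_cell X].

Definition cell_face : rel {ffun A -> {set B}} :=
  fun X Y => [forall a, X a \subset Y a].

Definition Bd_Hom : {set {set {ffun A -> {set B}}}} :=
  order_complex cell_face Hom.

End Hom.

Arguments Hom {dA dB} A B.
Arguments Bd_Hom {dA dB} A B.
Arguments cell_face {dA dB} A B.

Section Subcomplexes.
Variables (dP dQ : Order.disp_t) (P : finPOrderType dP) (Q : finPOrderType dQ).
Variables (x y : P).

(* The map P -> P - x sending x to y and fixing every other element. *)
Definition fold_map (hyx : y != x) (z : P) : del x :=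
  insubd (Del hyx) z.

Definition extend_cell (hyx : y != x) (X : {ffun del x -> {set Q}})
  : {ffun P -> {set Q}} :=
  [ffun z => X (fold_map hyx z)].

Definition Bd_Hom_del_dom (hyx : y != x) : {set {set {ffun P -> {set Q}}}} :=
  [set extend_cell hyx @: C | C : {set {ffun del x -> {set Q}}}
                              in Bd_Hom (del x) Q].

Definition include_cell (X : {ffun Q -> {set del x}}) : {ffun Q -> {set P}} :=
  [ffun a => [set val z | z in X a]].

Definition Hom_del_cod : {set {ffun Q -> {set P}}} :=
  [set include_cell X | X in Hom Q (del x)].

End Subcomplexes.

Arguments Bd_Hom_del_dom {dP dQ P} Q {x y} hyx.
Arguments Hom_del_cod {dP dQ P} Q x.

(* The remaining lemmas check that the two images above are the subposets of  *)
(* cells with X x = X y, respectively of cells not using x.                   *)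
Section Identifications.

Lemma HomP (dA dB : Order.disp_t) (A : finPOrderType dA) (B : finPOrderType dB)
    (X : {ffun A -> {set B}}) :
  reflect ((forall a, X a != set0) /\
           (forall a a' u v, a < a' -> u \in X a -> v \in X a' -> u < v))
          (X \in Hom A B).
Proof.
rewrite inE; apply: (iffP andP) => [[/forallP X0 /forallP Xm]|[X0 Xm]].
  split=> // a a' u v lt_aa' ua va'.
  pose f c := xchoose (set0Pn _ (X0 c)).
  have fP c : f c \in X c by exact: xchooseP.
  pose eta : {ffun A -> B} :=
    [ffun c => if c == a then u else if c == a' then v else f c].
  have etaP : [forall c, eta c \in X c].
    apply/forallP=> c; rewrite ffunE.
    by case: eqP => [->//|_]; case: eqP => [->//|_].
  move/implyP: (Xm eta) => /(_ etaP) /forallP /(_ a) /forallP /(_ a').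
  by rewrite lt_aa' !ffunE !eqxx /= [a' == a]eq_sym (lt_eqF lt_aa').
split; first exact/forallP.
apply/forallP=> eta; apply/implyP=> /forallP etaP.
apply/forallP=> a; apply/forallP=> a'; apply/implyP=> lt_aa'.
exact: (Xm a a').
Qed.

Variables (dP dQ : Order.disp_t) (P : finPOrderType dP) (Q : finPOrderType dQ).

Lemma lt_upcover (z w : P) : z < w -> exists2 u, u \in upcovers z & u <= w.
Proof.
move=> lt_zw.
pose I := [pred u | (z < u) && (u <= w)].
have Iw : I w by rewrite inE lt_zw lexx.
case: (arg_minnP (fun u => #|[set v : P | v < u]|) Iw) => u /andP[zu uw] umin.
exists u => //.
rewrite inE /covers zu /=; apply/existsPn => v; apply/negP => /andP[zv vu].
have := umin v; rewrite inE zv (le_trans (ltW vu) uw) => /(_ isT).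
rewrite leqNgt => /negP; apply; apply: proper_card; apply/properP; split.
  by apply/subsetP=> t; rewrite !inE => /lt_trans; apply.
by exists v; rewrite inE ?ltxx.
Qed.

Lemma gt_downcover (z w : P) : w < z -> exists2 u, u \in downcovers z & w <= u.
Proof.
move=> lt_wz.
pose I := [pred u | (u < z) && (w <= u)].
have Iw : I w by rewrite inE lt_wz lexx.
case: (arg_minnP (fun u => #|[set v : P | u < v]|) Iw) => u /andP[uz wu] umin.
exists u => //.
rewrite inE /covers uz /=; apply/existsPn => v; apply/negP => /andP[uv vz].
have := umin v; rewrite inE vz (le_trans wu (ltW uv)) => /(_ isT).
rewrite leqNgt => /negP; apply; apply: proper_card; apply/properP; split.
  by apply/subsetP=> t; rewrite !inE; apply: lt_trans.
by exists v; rewrite inE ?ltxx.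
Qed.

Variables (x y : P) (hyx : y != x).
Hypothesis hU : upcovers x \subset upcovers y.
Hypothesis hD : downcovers x \subset downcovers y.

Lemma fold_lt_up (z : P) : x < z -> y < z.
Proof.
case/lt_upcover=> u /(subsetP hU); rewrite inE => /andP[yu _].
exact: lt_le_trans.
Qed.

Lemma fold_lt_down (z : P) : z < x -> z < y.
Proof.
case/gt_downcover=> u /(subsetP hD); rewrite inE => /andP[uy _] zu.
exact: le_lt_trans uy.
Qed.

Lemma val_fold_map (z : P) : val (fold_map hyx z) = if z == x then y else z.
Proof. by rewrite /fold_map val_insubd /=; case: eqP. Qed.

Lemma fold_map_lt (a b : P) : a < b -> fold_map hyx a < fold_map hyx b.
Proof.
move=> ab; rewrite -lt_val !val_fold_map.
case: (eqVneq a x) => ax; case: (eqVneq b x) => bx //.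
- by rewrite ax bx ltxx in ab.
- by apply: fold_lt_up; rewrite -ax.
- by apply: fold_lt_down; rewrite -bx.
Qed.

Lemma fold_map_val (z : del x) : fold_map hyx (val z) = z.
Proof. by apply: val_inj; rewrite val_fold_map (negbTE (valP z)). Qed.

Lemma extend_cell_inj : injective (@extend_cell dP dQ P Q x y hyx).
Proof.
move=> X Y /ffunP e; apply/ffunP=> z.
by have := e (val z); rewrite !ffunE fold_map_val.
Qed.

Lemma extend_cell_face (X Y : {ffun del x -> {set Q}}) :
  cell_face P Q (extend_cell hyx X) (extend_cell hyx Y)
  = cell_face (del x) Q X Y.
Proof.
apply/forallP/forallP=> h a; last by rewrite !ffunE.
by have := h (val a); rewrite !ffunE fold_map_val.
Qed.

Lemma extend_cell_Hom :
  [set extend_cell hyx X | X in Hom (del x) Q]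
  = [set X in Hom P Q | X x == X y].
Proof.
apply/setP=> X; rewrite [in RHS]inE; apply/imsetP/andP.
  case=> Y /HomP[Y0 Ym] ->; split.
    apply/HomP; split=> [a|a a' u v aa']; first by rewrite ffunE.
    by rewrite !ffunE; apply: Ym; apply: fold_map_lt.
  rewrite !ffunE; apply/eqP; congr (Y _); apply: val_inj.
  by rewrite !val_fold_map eqxx (negbTE hyx).
case=> /HomP[X0 Xm] /eqP Xxy.
exists [ffun z : del x => X (val z)].
  apply/HomP; split=> [a|a a' u v aa']; first by rewrite ffunE.
  by rewrite !ffunE; apply: Xm.
apply/ffunP=> z; rewrite !ffunE val_fold_map.
by case: (eqVneq z x) => [->|].
Qed.

Lemma Bd_Hom_del_domE :
  Bd_Hom_del_dom Q hyx
  = order_complex (cell_face P Q) [set X in Hom P Q | X x == X y].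
Proof.
rewrite -extend_cell_Hom.
apply/setP=> D; apply/imsetP/idP.
  case=> C; rewrite !inE => /and3P[C0 CH /forall_inP Cc] ->.
  apply/and3P; split.
  - by rewrite imset_eq0.
  - exact: imsetS.
  - apply/forall_inP=> _ /imsetP[u uC ->].
    apply/forall_inP=> _ /imsetP[v vC ->].
    by rewrite !extend_cell_face; move/forall_inP: (Cc u uC); apply.
rewrite !inE => /and3P[D0 DH /forall_inP Dc].
have DE : D = extend_cell hyx @: (extend_cell hyx @^-1: D).
  apply/setP=> X; apply/idP/imsetP => [XD|[Y]]; last by rewrite inE => ? ->.
  have /imsetP[Y _ XY] := subsetP DH _ XD.
  by exists Y => //; rewrite inE -XY.
exists (extend_cell hyx @^-1: D) => //; rewrite inE; apply/and3P; split.
- by rewrite -(imset_eq0 (extend_cell hyx)) -DE.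
- apply/subsetP=> Y; rewrite inE => /(subsetP DH) /imsetP[Z ZH].
  by move/extend_cell_inj->.
- apply/forall_inP=> u; rewrite inE => uD.
  apply/forall_inP=> v; rewrite inE => vD.
  by rewrite -!extend_cell_face; move/forall_inP: (Dc _ uD); apply.
Qed.

Lemma Hom_del_codE :
  Hom_del_cod Q x = [set X in Hom Q P | [forall a, x \notin X a]].
Proof.
apply/setP=> X; rewrite [in RHS]inE; apply/imsetP/andP.
  case=> Y /HomP[Y0 Ym] ->; split.
    apply/HomP; split=> [a|a a' u v aa']; first by rewrite ffunE imset_eq0.
    rewrite !ffunE => /imsetP[u' u'Y ->] /imsetP[v' v'Y ->].
    by have := Ym a a' u' v' aa' u'Y v'Y.
  apply/forallP=> a; rewrite ffunE; apply/imsetP=> -[z _ xz].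
  by have := valP z; rewrite -xz eqxx.
case=> /HomP[X0 Xm] /forallP Xx.
exists [ffun a => [set z : del x | val z \in X a]]; last first.
  apply/ffunP=> a; rewrite !ffunE; apply/setP=> z; apply/idP/imsetP.
    move=> zX; have zx : z != x by apply: contraNneq (Xx a) => <-.
    by exists (Del zx); rewrite // inE.
  by case=> w; rewrite inE => ? ->.
apply/HomP; split=> [a|a a' u v aa'].
  rewrite ffunE; have /set0Pn[z zX] := X0 a.
  have zx : z != x by apply: contraNneq (Xx a) => <-.
  by apply/set0Pn; exists (Del zx); rewrite inE.
by rewrite !ffunE !inE; apply: Xm.
Qed.

End Identifications.

(* Main.v *)
Require Import Defs.
From mathcomp Require Import all_boot all_order.

(** Both collapses remove the cells in pairs [C], [e |: C], where the toggled
    vertex [e] depends only on the part of [C] inside a set [B] of bad vertices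
    and is itself not bad; removing the pairs with a large bad part first makes
    each of them a free face with its coface.

    For [Hom Q P], a cell is a set of pairs in [Q * P], the bad pairs are the
    [(a, x)], and the toggled vertex is [(a, y)] for a chosen bad [(a, x)].

    For [Bd_Hom P Q], the map enlarging [X x] to [X x :|: X y] is a closure
    operator on the cells, and the map shrinking [X x] to [X y] is an interior
    operator on its fixed points. A closure operator [phi] makes the order
    complex collapse onto that of its fixed points: the bad vertices of a chain
    are those moved by [phi], and the toggled vertex is the image under [phi]
    of the largest of them. *)

Set Implicit Arguments.
Unset Strict Implicit.
Unset Printing Implicit Defensive.

Import Order.TTheory.

(** * Collapses from matchings and from toggling a vertex *)

Section Collapses.
Variables (T : finType) (le : rel T).
Implicit Types K L M : {set T}.

Lemma collapses_trans K L M :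
  collapses le K L -> collapses le L M -> collapses le K M.
Proof. by move=> KL; elim=> // L' M' _ KL' /(collapses_step KL'). Qed.

(** Induction on the number of cells outside [L]. Among these, a cell of maximal rank [mu] that lies
    below its partner has that partner as its only proper coface, so the pair can be removed; the
    rank expresses acyclicity of the matching. *)
Lemma matching_collapses (f : T -> T) (mu : T -> nat) K L :
    L \subset K ->
    {in K :\: L, forall s, [/\ f s \in K :\: L, f (f s) = s, f s != s,
                               mu (f s) = mu s & le s (f s) || le (f s) s]} ->
    {in K :\: L & K, forall s r, le s (f s) -> le s r ->
       [\/ r = s, r = f s | r \in K :\: L /\ mu s < mu r]} ->
  collapses le K L.
Proof.
have [n] := ubnP #|K :\: L|; elim: n K => // n IHn K leKn LK fP up.
have [KL0|[s0 s0KL]] := set_0Vmem (K :\: L).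
  suff -> : K = L by constructor.
  by apply/eqP; rewrite eqEsubset LK -setD_eq0 KL0 eqxx.
case: (arg_maxnP mu s0KL) => s1 s1KL s1max.
(* Partners have equal rank, so the lower one of the pair of [s1] also has maximal rank. *)
have [s [sKL smax les]] : exists s, [/\ s \in K :\: L,
    forall r, r \in K :\: L -> mu r <= mu s & le s (f s)].
  have [fs1KL ffs1 _ mufs1 /orP[le1|le1]] := fP _ s1KL; first by exists s1.
  by exists (f s1); split; rewrite ?mufs1 ?ffs1.
have [fsKL ffs fs_neq mufs _] := fP _ sKL.
have [sK fsK] : s \in K /\ f s \in K.
  by split; [move: sKL | move: fsKL]; rewrite inE => /andP[].
set K' := K :\: [set s; f s].
have K'L u : (u \in K' :\: L) = [&& u != s, u != f s & u \in K :\: L].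
  by rewrite !inE negb_or; do !case: (_ == _); case: (u \in L).
apply: (@collapses_trans _ K').
  apply: (collapses_step (collapses_refl le K)).
  exists s, (f s); split=> // [|r rK ler]; first by rewrite eq_sym fs_neq.
  by case: (up s r) => // [||[/smax]]; [left | right | rewrite leqNgt => /negP].
apply: IHn => [|||u r].
- rewrite -ltnS; apply: leq_trans leKn; rewrite ltnS.
  apply: proper_card; apply/properP; split.
    by apply/subsetP=> u; rewrite K'L => /and3P[].
  by exists s => //; rewrite K'L eqxx.
- apply/subsetP=> u uL; rewrite !inE (subsetP LK) // andbT negb_or.
  by apply/andP; split; apply: contraTneq uL => ->;
    [move: sKL | move: fsKL]; rewrite inE => /andP[].
- move=> u; rewrite K'L => /and3P[us ufs uKL].
  have [fuKL ffu fu_neq mufu lefu] := fP _ uKL; split=> //.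
  (* Since [f] is an involution, partners of surviving cells survive. *)
  rewrite K'L fuKL andbT; apply/andP; split.
    by apply: contraNneq ufs => <-; rewrite ffu.
  by apply: contraNneq us => fufs; rewrite -ffu fufs ffs.
- rewrite K'L => /and3P[_ _ uKL] rK' leu ler.
  move: (rK'); rewrite [r \in K']inE => /andP[rN rK].
  case: (up u r uKL rK leu ler) => [->|->|[rKL lt_ur]];
    [by constructor 1 | by constructor 2 | constructor 3].
  by split=> //; rewrite K'L rKL andbT -negb_or -in_set2.
Qed.

End Collapses.

(** Serves to pass from sets of pairs to the cells of [Hom Q P]. *)
Lemma collapses_imset (T T' : finType) (le : rel T) (le' : rel T') (h : T -> T')
    (K L : {set T}) :
    injective h -> (forall u v, le' (h u) (h v) = le u v) ->
  collapses le K L -> collapses le' (h @: K) (h @: L).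
Proof.
move=> hI hle; elim=> [|{}L M _ KL [s [t [sL tL /andP[st lest] up ->]]]].
  by constructor.
apply: (collapses_step KL); exists (h s), (h t); split; rewrite ?imset_f //.
- by rewrite (inj_eq hI) st hle.
- move=> _ /imsetP[r rL ->]; rewrite hle => /(up r rL).
  by case=> ->; [left | right].
- apply/setP=> v; rewrite in_setD in_set2; apply/imsetP/andP.
    case=> u; rewrite in_setD in_set2 => /andP[uN uL] ->.
    by rewrite !(inj_eq hI) imset_f.
  case=> vN /imsetP[u uL vu]; exists u => //.
  by rewrite in_setD in_set2 uL andbT; move: vN; rewrite vu !(inj_eq hI).
Qed.

(** As [e] is not bad, toggling it keeps the bad part and hence the choice of [e], so toggling is an
    involution. *)
Lemma toggle_collapses (T : finType) (B : {set T}) (K : {set {set T}}) :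
    {in K, forall C0, C0 :&: B != set0 -> exists2 e, e \notin B &
       {in K, forall C, C :&: B = C0 :&: B -> e |: C \in K /\ C :\ e \in K}} ->
  collapses (@simplex_face T) K [set C in K | C :&: B == set0].
Proof.
(* The vertex [b] is a default value for the choice of [e] below; if [B] is empty, nothing has to be
   removed. *)
move=> toggle; have [B0|[b _]] := set_0Vmem B.
  suff -> : [set C in K | C :&: B == set0] = K by constructor.
  by apply/setP=> C; rewrite inE B0 setI0 eqxx andbT.
have /fin_all_exists[e eP] : forall N : {set T}, exists e,
    {in K, forall C, C :&: B = N -> N != set0 ->
       [/\ e \notin B, e |: C \in K & C :\ e \in K]}.
  move=> N; have [/exists_inP[C0 C0K /eqP <-]|noC] :=
    boolP [exists C0 in K, C0 :&: B == N]; last first.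
    by exists b => C CK CN; case/exists_inP: noC; exists C; rewrite ?CN.
  have [->|/(toggle _ C0K)[e eB eK]] := eqVneq (C0 :&: B) set0.
    by exists b.
  by exists e => C CK CN _; have [] := eK _ CK CN.
have {eP}eP (C : {set T}) : C \in K -> C :&: B != set0 ->
    let c := e (C :&: B) in [/\ c \notin B, c |: C \in K & C :\ c \in K].
  by move=> CK; apply: eP.
set L := [set _ in _ | _].
have KLE (C : {set T}) : (C \in K :\: L) = (C \in K) && (C :&: B != set0).
  by rewrite in_setD [C \in L]inE; case: (C \in K); rewrite ?andbF ?andbT.
pose f (C : {set T}) :=
  if e (C :&: B) \in C then C :\ e (C :&: B) else e (C :&: B) |: C.
have fB (C : {set T}) : C \in K -> C :&: B != set0 -> f C :&: B = C :&: B.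
  move=> CK /(eP _ CK)[eNB _ _]; apply/setP=> u; rewrite /f.
  case: ifP => _; rewrite !inE;
    by have [->|] := eqVneq u (e _); rewrite ?(negbTE eNB) ?andbF.
(* The second summand compensates for the possible loss of one vertex in the
   first when [C] acquires bad vertices and so changes its toggled vertex. *)
apply: (@matching_collapses _ _ f
          (fun C => #|C :\ e (C :&: B)| + #|C :&: B|)).
- by apply/subsetP=> C; rewrite inE => /andP[].
- move=> C; rewrite KLE => /andP[CK CB]; rewrite KLE !fB // CB andbT.
  rewrite {2}/f fB // /f; set c := e _; have [cC|cC] := boolP (c \in C).
    rewrite setD11 setD1K //; split=> //; first by case: (eP C).
    + by rewrite eqEsubset subD1set negb_and; apply/orP; right;
         apply/subsetPn; exists c; rewrite ?setD11.
    + by congr (#|pred_of_set _| + _); apply/setP=> u; rewrite !inE andbA andbb.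
    + by rewrite /simplex_face subD1set orbT.
  rewrite setU11 setU1K //; split=> //; first by case: (eP C).
  + by apply: contraNneq cC => <-; rewrite setU11.
  + by congr (#|pred_of_set _| + _); apply/setP=> u; rewrite !inE;
       have [->|] := eqVneq u c; rewrite ?(negbTE cC).
  + by rewrite /simplex_face subsetUr.
move=> s r; rewrite KLE /simplex_face => /andP[sK sB] rK sfs sr.
(* A cell below its partner is the one without the toggled vertex. *)
have {sfs}es : e (s :&: B) \notin s.
  move: sfs; rewrite /f; case: ifP => // es /subsetP/(_ _ es).
  by rewrite setD11.
have sD : s :\ e (s :&: B) = s.
  by apply/eqP; rewrite eqEsubset subD1set subsetD1 subxx.
(* With the same bad part, [r] has the same toggled vertex: either [r] agrees with [s] up to this
   vertex, or the first summand of the rank grows. *)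
have [rsB|rsB] := eqVneq (r :&: B) (s :&: B).
  rewrite KLE rsB rK sB sD ltn_add2r.
  have ssub : s \subset r :\ e (s :&: B) by rewrite subsetD1 sr.
  have [sE|sN] := eqVneq s (r :\ e (s :&: B)); last first.
    by constructor 3; split=> //; rewrite proper_card // properEneq sN.
  have [er|er] := boolP (e (s :&: B) \in r).
    by constructor 2; rewrite /f (negbTE es) {2}sE setD1K.
  by constructor 1; apply/eqP; rewrite eqEsubset sr andbT sE subsetD1 subxx.
constructor 3; have srB : s :&: B \proper r :&: B.
  by rewrite properEneq eq_sym rsB setSI.
split; first by rewrite KLE rK -proper0 (sub_proper_trans (sub0set _) srB).
have sr' : s \proper r.
  by rewrite properEneq sr andbT; apply: contra_neq rsB => ->.
(* [r] has at least one vertex more than [s], so dropping its toggled vertex cannot push the first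
   summand below that of [s]; the second grows strictly. *)
rewrite sD -addnS leq_add ?proper_card //.
have := proper_card sr'; rewrite (cardsD1 (e (r :&: B)) r).
by case: (_ \in _); rewrite ?ltnS // => /ltnW.
Qed.

(** * Order complexes and closure operators *)

Section ClosureOperator.
Variables (T : finType) (le : rel T).
Hypotheses (le_refl : reflexive le) (le_trans : transitive le).

(** Take an element of the chain with the most elements of [T] below it: one above it but not below
    it would have strictly more. *)
Lemma chain_max (C : {set T}) :
    C != set0 -> {in C &, forall u v, le u v || le v u} ->
  exists2 c, c \in C & {in C, forall u, le u c}.
Proof.
case/set0Pn=> c0 c0C chainC.
case: (arg_maxnP (fun c => #|[set u | le u c]|) c0C) => c cC cmax.
exists c => // u uC; have /orP[//|cu] := chainC u c uC cC.
have : #|[set v | le v u]| <= #|[set v | le v c]| by apply: cmax.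
rewrite leqNgt; apply: contraNT => nuc.
apply: proper_card; apply/properP; split.
  by apply/subsetP=> v; rewrite !inE => /le_trans; apply.
by exists u; rewrite inE.
Qed.

Lemma order_complexP (F C : {set T}) :
  reflect [/\ C != set0, C \subset F & {in C &, forall u v, le u v || le v u}]
          (C \in order_complex le F).
Proof.
rewrite inE; apply: (iffP and3P) => -[C0 CF chainC]; split=> //.
  by move=> u v uC vC; move/forall_inP/(_ u uC)/forall_inP/(_ v vC): chainC.
by apply/forall_inP=> u uC; apply/forall_inP=> v; apply: chainC.
Qed.

(** Let [c] be the largest moved vertex. Its image [phi c] is comparable with the whole chain: moved
    vertices and fixed ones below [c] lie below [phi c], and fixed ones above [c] lie above [phi c]
    by monotonicity. *)
Lemma closure_collapses (F : {set T}) (phi : T -> T) :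
    {in F, forall u, [/\ phi u \in F, le u (phi u) & phi (phi u) = phi u]} ->
    {in F &, forall u v, le u v -> le (phi u) (phi v)} ->
  collapses (@simplex_face T) (order_complex le F)
            (order_complex le [set u in F | phi u == u]).
Proof.
move=> phiP phi_mono; set K := order_complex le F.
pose B := [set u in F | phi u != u].
have -> : order_complex le [set u in F | phi u == u]
    = [set C in K | C :&: B == set0].
  apply/setP=> C; rewrite inE; apply/order_complexP/andP.
    case=> C0 /subsetP CF chainC; split.
      apply/order_complexP; split=> //.
      by apply/subsetP=> u /CF; rewrite inE => /andP[].
    apply/eqP/setP=> u; rewrite !inE; apply/andP=> -[/CF].
    by rewrite inE => /andP[-> ->].
  case=> /order_complexP[C0 /subsetP CF chainC] /eqP CB; split=> //.
  apply/subsetP=> u uC; have /setP/(_ u) := CB.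
  by rewrite !inE uC CF //= => /negbFE.
apply: toggle_collapses => C0 /order_complexP[_ C0F chainC0] C0B.
have [|c cC0B cmax] := chain_max C0B.
  by move=> u v /setIP[uC0 _] /setIP[vC0 _]; apply: chainC0.
have [cF cN] : c \in F /\ phi c != c.
  by case/setIP: cC0B => _; rewrite inE => /andP[].
have [phicF le_c phiphic] := phiP c cF.
exists (phi c); first by rewrite inE phiphic eqxx andbF.
move=> C /order_complexP[_ CF chainC] CB.
have cC : c \in C by move: cC0B; rewrite -CB => /setIP[].
have comp u : u \in C -> le u (phi c) || le (phi c) u.
  move=> uC; have uF := subsetP CF u uC.
  have [/eqP phiu|uN] := boolP (phi u == u); last first.
    by rewrite (le_trans _ le_c) // cmax // -CB !inE uC uF.
  have /orP[uc|cu] := chainC u c uC cC; first by rewrite (le_trans uc).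
  by rewrite -{2}phiu phi_mono ?orbT.
split; apply/order_complexP; split.
- by apply/set0Pn; exists (phi c); rewrite setU11.
- by rewrite subUset sub1set phicF.
- move=> u v /setU1P[->|uC] /setU1P[->|vC]; rewrite ?le_refl ?comp //.
    by rewrite orbC comp.
  exact: chainC.
(* The moved vertex [c] stays, so the chain does not become empty. *)
- by apply/set0Pn; exists c; rewrite !inE eq_sym cN.
- by rewrite subDset subsetU // CF orbT.
- by move=> u v /setD1P[_ uC] /setD1P[_ vC]; apply: chainC.
Qed.

End ClosureOperator.

(** Lets an interior operator count as a closure operator for the reversed order. *)
Lemma order_complex_dual (T : finType) (le : rel T) (F : {set T}) :
  order_complex (fun u v => le v u) F = order_complex le F.
Proof.
by apply/setP=> C; apply/order_complexP/order_complexP => -[C0 CF chainC];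
  split=> // u v uC vC; rewrite orbC chainC.
Qed.

(** * The face relation as a preorder *)

Section CellFace.
Variables (dA dB : Order.disp_t) (A : finPOrderType dA) (B : finPOrderType dB).

Lemma cell_face_refl : reflexive (cell_face A B).
Proof. by move=> X; apply/forallP. Qed.

Lemma cell_face_trans : transitive (cell_face A B).
Proof.
move=> Y X Z /forallP XY /forallP YZ; apply/forallP=> a.
exact: subset_trans (YZ a).
Qed.

End CellFace.

(** * The two collapses for a fold *)

Section Fold.
Variables (dP dQ : Order.disp_t) (P : finPOrderType dP) (Q : finPOrderType dQ).
Variables (x y : P).
Hypotheses (hyx : y != x) (hU : upcovers x \subset upcovers y)
  (hD : downcovers x \subset downcovers y).

Definition set_at_x (S : {set Q}) (X : {ffun P -> {set Q}}) :
  {ffun P -> {set Q}} := [ffun z => if z == x then S else X z].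

(** Elements of [X y] are admissible at [x], since whatever lies strictly above or below [x] lies on
    the same side of [y]. *)
Lemma set_at_x_Hom (S : {set Q}) X :
    X \in Hom P Q -> S != set0 -> S \subset X x :|: X y ->
  set_at_x S X \in Hom P Q.
Proof.
case/HomP=> X0 Xm S0 /subsetP SX; apply/HomP; split=> [a|a a' u v].
  by rewrite ffunE; case: ifP.
rewrite !ffunE; have [->|_] := eqVneq a x; have [->|_] := eqVneq a' x.
- by rewrite ltxx.
- move=> xa' /SX/setUP[] uX vX; first exact: Xm xa' uX vX.
  exact: Xm (fold_lt_up hU xa') uX vX.
- move=> ax uX /SX/setUP[] vX; first exact: Xm ax uX vX.
  exact: Xm (fold_lt_down hD ax) uX vX.
- exact: Xm.
Qed.

Lemma Bd_Hom_collapses :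
  collapses (@simplex_face _) (Bd_Hom P Q) (Bd_Hom_del_dom Q hyx).
Proof.
have yx := negbTE hyx.
rewrite Bd_Hom_del_domE //.
pose up (X : {ffun P -> {set Q}}) := set_at_x (X x :|: X y) X.
pose down (X : {ffun P -> {set Q}}) := set_at_x (X y) X.
set refl := @cell_face_refl _ _ P Q; set trans := @cell_face_trans _ _ P Q.
(* The intermediate stage: cells with [X y] inside [X x], reached by [up] and left by [down]. *)
pose G := [set X in Hom P Q | up X == X].
have GP X : X \in G -> X \in Hom P Q /\ X y \subset X x.
  rewrite inE => /andP[XH /eqP/ffunP/(_ x)].
  by rewrite ffunE eqxx => /setUidPl.
apply: (@collapses_trans _ _ _ (order_complex (cell_face P Q) G)).
  apply: closure_collapses => //.
  - move=> X XH; have [X0 _] := HomP _ XH; split.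
    + apply: set_at_x_Hom => //.
      by have /set0Pn[u uX] := X0 x; apply/set0Pn; exists u; rewrite inE uX.
    + by apply/forallP=> z; rewrite ffunE; case: eqP => // ->; rewrite subsetUl.
    + apply/ffunP=> z; rewrite /up !ffunE eqxx yx -setUA setUid.
      by case: (z == x).
  - move=> X Y _ _ /forallP XY; apply/forallP=> z; rewrite !ffunE.
    by case: ifP => _ //; apply: setUSS.
(* In the reversed face order [down] is extensive on [G], as [X y] lies inside [X x] there. *)
rewrite -!(order_complex_dual (cell_face P Q)).
have -> : [set X in Hom P Q | X x == X y] = [set X in G | down X == X].
  apply/setP=> X; rewrite !inE; case: (is_hom_cell X) => //=.
  apply/eqP/andP=> [Xxy|[_ /eqP/ffunP/(_ x)]]; last by rewrite ffunE eqxx.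
  split; apply/eqP/ffunP=> z; rewrite ffunE; case: eqP => // ->.
    by rewrite Xxy setUid.
  by [].
apply: closure_collapses => //; first by move=> Y X Z /[swap]; apply: trans.
- move=> X /GP[XH Xyx]; have [X0 _] := HomP _ XH; split.
  (* At both [x] and [y] the cell [down X] has the value [X y], so [up] fixes it. *)
  + rewrite inE set_at_x_Hom ?subsetUr //=.
    apply/eqP/ffunP=> z; rewrite /up /down !ffunE eqxx yx setUid.
    by case: (z == x).
  + by apply/forallP=> z; rewrite ffunE; case: eqP => // ->.
  + by apply/ffunP=> z; rewrite /down !ffunE yx; case: (z == x).
- move=> X Y _ _ /forallP XY; apply/forallP=> z; rewrite !ffunE.
  by case: ifP.
Qed.

(** Inverse to taking the graph of a cell; as graphs, cells of a product of simplices become plain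
    sets, to which [toggle_collapses] applies. *)
Definition cell_of_pairs (Z : {set Q * P}) : {ffun Q -> {set P}} :=
  [ffun a => [set p | (a, p) \in Z]].

Lemma mem_cell_of_pairs Z a p : (p \in cell_of_pairs Z a) = ((a, p) \in Z).
Proof. by rewrite ffunE inE. Qed.

Lemma cell_of_pairs_face Z Z' :
  cell_face Q P (cell_of_pairs Z) (cell_of_pairs Z') = simplex_face Z Z'.
Proof.
apply/forallP/subsetP=> ZZ' => [[a p]|a]; last first.
  by apply/subsetP=> p; rewrite !mem_cell_of_pairs; apply: ZZ'.
by rewrite -!mem_cell_of_pairs; apply: (subsetP (ZZ' a)).
Qed.

Lemma cell_of_pairs_inj : injective cell_of_pairs.
Proof.
by move=> Z Z' ZZ'; apply/setP=> -[a p]; rewrite -!mem_cell_of_pairs ZZ'.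
Qed.

Lemma cell_of_pairs_imset (K : {set {ffun Q -> {set P}}}) :
  cell_of_pairs @: (cell_of_pairs @^-1: K) = K.
Proof.
apply/setP=> X; apply/imsetP/idP=> [[Z]|XK]; first by rewrite inE => ? ->.
have XE : X = cell_of_pairs [set ap | ap.2 \in X ap.1].
  by apply/ffunP=> a; apply/setP=> p; rewrite mem_cell_of_pairs inE.
by exists [set ap | ap.2 \in X ap.1]; rewrite // inE -XE.
Qed.

(** If [x] lies in [X a], then [y] may be added to [X a] because it satisfies every order constraint
    that [x] does, and removed because [x] keeps [X a] nonempty. *)
Lemma Hom_collapses :
  collapses (cell_face Q P) (Hom Q P) (Hom_del_cod Q x).
Proof.
rewrite Hom_del_codE -[Hom Q P]cell_of_pairs_imset.
set K := _ @^-1: _; pose B := [set ap : Q * P | ap.2 == x].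
have KE Z : (Z \in K) = (cell_of_pairs Z \in Hom Q P) by rewrite in_set.
have -> : [set X in cell_of_pairs @: K | [forall a, x \notin X a]]
    = cell_of_pairs @: [set Z in K | Z :&: B == set0].
  apply/setP=> X; rewrite inE; apply/andP/imsetP.
    case=> /imsetP[Z ZK ->] /forallP noX; exists Z => //; rewrite inE ZK /=.
    apply/eqP/setP=> -[a p]; rewrite !inE /=; apply/andP=> -[apZ /eqP px].
    by move: (noX a); rewrite mem_cell_of_pairs -px apZ.
  case=> Z; rewrite inE => /andP[ZK /eqP/setP ZB] ->; rewrite imset_f //.
  split=> //; apply/forallP=> a; rewrite mem_cell_of_pairs.
  by have := ZB (a, x); rewrite !inE eqxx andbT => ->.
apply: (collapses_imset cell_of_pairs_inj cell_of_pairs_face).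
apply: toggle_collapses => Z0 _ /set0Pn[[a p]] apZ0.
exists (a, y); first by rewrite inE.
move=> Z ZK ZB; have axZ : (a, x) \in Z.
  by move: apZ0; rewrite -ZB !inE /= => /andP[apZ /eqP <-].
move: ZK; rewrite KE => /HomP[Z0' Zm].
have {}Zm b b' u v : (b < b')%O -> (b, u) \in Z -> (b', v) \in Z -> (u < v)%O.
  by move=> bb' uZ vZ; apply: (Zm b b'); rewrite ?mem_cell_of_pairs.
have mU b u : (b, u) \in (a, y) |: Z -> (b, u) \in Z \/ b = a /\ u = y.
  by case/setU1P=> [[-> ->]|]; [right | left].
split; rewrite KE; apply/HomP; split=> [b|b b' u v bb'].
- have /set0Pn[u] := Z0' b; rewrite mem_cell_of_pairs => uZ.
  by apply/set0Pn; exists u; rewrite mem_cell_of_pairs setU1r.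
- rewrite !mem_cell_of_pairs => /mU[uZ|[ba ->]] /mU[vZ|[b'a ->]].
  + exact: Zm bb' uZ vZ.
  + by apply: (fold_lt_down hD); apply: Zm bb' uZ _; rewrite b'a.
  + by apply: (fold_lt_up hU); apply: Zm bb' _ vZ; rewrite ba.
  + by rewrite ba b'a ltxx in bb'.
- have [->|ba] := eqVneq b a.
    apply/set0Pn; exists x; rewrite mem_cell_of_pairs in_setD1 axZ andbT.
    by rewrite xpair_eqE eqxx /= eq_sym.
  have /set0Pn[u] := Z0' b; rewrite mem_cell_of_pairs => uZ.
  apply/set0Pn; exists u; rewrite mem_cell_of_pairs in_setD1 uZ andbT.
  by rewrite xpair_eqE (negbTE ba).
- rewrite !mem_cell_of_pairs => /setD1P[_ uZ] /setD1P[_ vZ].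
  exact: Zm bb' uZ vZ.
Qed.

End Fold.

Theorem theorem3p7 (dP dQ : Order.disp_t)
    (P : finPOrderType dP) (Q : finPOrderType dQ) (x y : P)
    (hyx : y != x)
    (hU : upcovers x \subset upcovers y)
    (hD : downcovers x \subset downcovers y) :
  collapses (@simplex_face _) (Bd_Hom P Q) (Bd_Hom_del_dom Q hyx) /\
  collapses (cell_face Q P) (Hom Q P) (Hom_del_cod Q x).
Proof.
by split; [apply: Bd_Hom_collapses | exact: (Hom_collapses Q hyx hU hD)].
Qed.
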